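(* Let $k$ be a positive integer. The $k$-labeled Gromov-Hausdorff distance $\mathsf{GH}_k$ defines a metric on the space of $k$-labeled metric spaces, considered up to $k$-isomorphism. That is, for all $k$-labeled metric spaces $\mathcal{X},\mathcal{Y},\mathcal{Z}$: $\mathsf{GH}_k(\mathcal{X},\mathcal{Y})\in[0,\infty)$; $\mathsf{GH}_k(\mathcal{X},\mathcal{Y})=\mathsf{GH}_k(\mathcal{Y},\mathcal{X})$; $\mathsf{GH}_k(\mathcal{X},\mathcal{Z})\le \mathsf{GH}_k(\mathcal{X},\mathcal{Y})+\mathsf{GH}_k(\mathcal{Y},\mathcal{Z})$; and $\mathsf{GH}_k(\mathcal{X},\mathcal{Y})=0$ if and only if $\mathcal{X}$ and $\mathcal{Y}$ are $k$-isomorphic.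
   Context: A $k$-labeled metric space is a triple $\mathcal{X}=(X,d_X,L_X)$, where $(X,d_X)$ is a compact metric space and $L_X=(X_1,\ldots,X_k)$ is a finite sequence of nonempty subsets $X_i\subset X$ with $X=\bigcup_{i=1}^k X_i$ (the $X_i$ may overlap). For sets $A,B$, $\mathcal{C}(A,B)$ denotes the set of correspondences, i.e. subsets $C\subset A\times B$ whose coordinate projections to $A$ and to $B$ are both surjective. For nonempty $X_1,X_2\subset X$, $Y_1,Y_2\subset Y$, $C_1\in\mathcal{C}(X_1,Y_1)$ and $C_2\in\mathcal{C}(X_2,Y_2)$, define $$\mathrm{dis}(C_1,C_2):=\sup_{(x_1,y_1)\in C_1,\ (x_2,y_2)\in C_2}|d_X(x_1,x_2)-d_Y(y_1,y_2)|.$$ For $k$-labeled metric spaces $\mathcal{X}=(X,d_X,(X_i))$ and $\mathcal{Y}=(Y,d_Y,(Y_i))$, $$\mathsf{GH}_k(\mathcal{X},\mathcal{Y}):=\frac12\inf_{(C_1,\ldots,C_k)}\ \max_{i,j=1,\ldots,k}\mathrm{dis}(C_i,C_j),$$ the infimum being over all $k$-tuples with $C_i\in\mathcal{C}(X_i,Y_i)$. $\mathcal{X}$ and $\mathcal{Y}$ are $k$-isomorphic if there exists an isometry (distance-preserving bijection) $\phi:X\to Y$ such that $\phi(X_i)=Y_i$ for each $i=1,\ldots,k$.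
   Formalization: The implication from GH_k(X,Y)=0 to k-isomorphic is proved for closed labels X_i, Y_i only; it fails for arbitrary labels, e.g. ([0,1],[0,1)) and ([0,1],[0,1]) on [0,1] are at distance 0 but not 2-isomorphic. *)

(* Defs.v *)
From HB Require Import structures.
From mathcomp Require Import all_boot all_order all_algebra.
From mathcomp Require Import all_classical all_reals all_analysis.

Set Implicit Arguments.
Unset Strict Implicit.
Unset Printing Implicit Defensive.

Import Order.TTheory GRing.Theory Num.Theory.

Local Open Scope classical_set_scope.
Local Open Scope ring_scope.

Record klabeled_space (R : realType) (k : nat) := KLabeledSpace {
  kl_space :> metricType R;
  kl_compact : compact [set: kl_space];
  kl_label : 'I_k -> set kl_space;
  kl_label_nonempty : forall i, kl_label i !=set0;
  kl_label_cover : \bigcup_i kl_label i = [set: kl_space]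
}.

Arguments kl_label {R k} X i : rename.

Definition correspondence (S T : Type) (A : set S) (B : set T) (C : set (S * T))
    : Prop :=
  [/\ C `<=` A `*` B, fst @` C = A & snd @` C = B].

(* Suprema and infima are taken in the extended reals, because the real-valued
   [sup] and [inf] return a default value on sets without a bound; in this way
   finiteness of the Gromov-Hausdorff distance is a genuine claim. *)
Definition distortion (R : realType) (X Y : metricType R) (C1 C2 : set (X * Y))
    : \bar R :=
  ereal_sup [set (`|mdist p.1.1 p.2.1 - mdist p.1.2 p.2.2|)%:E
            | p in C1 `*` C2].

Definition ktuple_correspondence (R : realType) (k : nat)
    (X Y : klabeled_space R k) (C : 'I_k -> set (X * Y)) : Prop :=
  forall i, correspondence (kl_label X i) (kl_label Y i) (C i).

(* [-oo] is the neutral element of [maxe]; for [0 < k] the maximum ranges over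
   a nonempty family, so that this value does not occur. *)
Definition max_distortion (R : realType) (k : nat) (X Y : klabeled_space R k)
    (C : 'I_k -> set (X * Y)) : \bar R :=
  \big[maxe/-oo%E]_(i < k) \big[maxe/-oo%E]_(j < k) distortion (C i) (C j).

Definition GHk (R : realType) (k : nat) (X Y : klabeled_space R k) : \bar R :=
  ((2^-1)%:E * ereal_inf [set max_distortion C
                         | C in @ktuple_correspondence R k X Y])%E.

Definition k_isomorphic (R : realType) (k : nat) (X Y : klabeled_space R k)
    : Prop :=
  exists phi : X -> Y,
    [/\ bijective phi,
        forall x x' : X, mdist (phi x) (phi x') = mdist x x' &
        forall i, phi @` kl_label X i = kl_label Y i].

(* Closed labels are needed for the implication from [GHk X Y = 0] to
   [k_isomorphic X Y]: on [0, 1], the label sequences ([0, 1], [0, 1[) and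
   ([0, 1], [0, 1]) are at distance 0 without being isomorphic. *)
Definition closed_labels (R : realType) (k : nat) (X : klabeled_space R k)
    : Prop :=
  forall i, closed (kl_label X i).

(* Main.v *)
(** If the distance vanishes, choose correspondences of distortion tending to 0
    and a nonprincipal ultrafilter on the indices. The pairs that are limits,
    along the ultrafilter, of pairs in these correspondences form a relation
    that preserves distances, hence is the graph of an injective partial map.
    By compactness of the labels it relates every point of a label to a point
    of the same label, in both directions, so it is the graph of the desired
    isomorphism. The ultrafilter replaces the usual diagonal argument over a
    countable dense subset. *)
Require Import Defs.
From mathcomp Require Import all_boot all_order all_algebra.
From mathcomp Require Import all_classical all_reals all_analysis.
From mathcomp Require Import lra.

Import Order.TTheory GRing.Theory Num.Theory.
Import numFieldNormedType.Exports.

Local Open Scope classical_set_scope.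
Local Open Scope ring_scope.

Set Implicit Arguments.
Unset Strict Implicit.
Unset Printing Implicit Defensive.

(** * Bounds on distances, and images of ultrafilters *)

Lemma mdist_lipschitz (R : realType) (X : metricType R) (x y x' y' : X) :
  `|mdist x y - mdist x' y'| <= mdist x x' + mdist y y'.
Proof.
have h1 := metric_triangle x x' y; have h2 := metric_triangle x' y' y.
have h3 := metric_triangle x' x y'; have h4 := metric_triangle x y y'.
rewrite (metric_sym y' y) in h2; rewrite (metric_sym x' x) in h3.
by rewrite ler_distl; apply/andP; split; lra.
Qed.

Lemma compact_mdist_bounded (R : realType) (X : metricType R) :
  compact [set: X] -> exists M : R, forall x x' : X, mdist x x' <= M.
Proof.
move=> cX; have [[x0 _]|nX] := pselect ([set: X] !=set0); last first.
  by exists 0 => x; case: nX; exists x.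
have cd : continuous (mdist x0 : X -> R).
  move=> x; apply/cvgrPdist_lt => e e0.
  apply/metricType_numDomainType.nbhs_mdistP; exists e => // y /= xy.
  by have := mdist_lipschitz x0 x x0 y; rewrite mdistxx add0r => /le_lt_trans; apply.
have : compact [set mdist x0 x | x in [set: X]].
  by apply: continuous_compact => //; apply: continuous_subspaceT.
(* Boundedness provides a bound only beyond [M], hence [M + 1]; the factor 2 comes from the triangle
   inequality through [x0]. *)
move=> /compact_bounded[M [_ hM]]; exists (2 * (M + 1)) => x x'.
have b y : mdist x0 y <= M + 1.
  rewrite -[mdist x0 y]ger0_norm ?mdist_ge0//.
  by apply: (hM (M + 1)); [rewrite ltrDl|exists y].
have := metric_triangle x x0 x'; rewrite (metric_sym x x0).
by have := b x; have := b x'; lra.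
Qed.

Lemma fmap_ultra (T U : Type) (f : T -> U) (F : set_system T) :
  UltraFilter F -> UltraFilter (f @ F).
Proof.
move=> FU; have FP : ProperFilter F by case: FU.
split; first exact: fmap_proper_filter.
move=> G GP FG; apply/seteqP; split=> [A GA|A /FG//].
have [//|FnA] := in_ultra_setVsetC (f @^-1` A) FU.
have GnA : G (~` A) by exact: FG.
by have [u []] := filter_ex (filterI GA GnA).
Qed.

(** * Real bounds on distortions, and the metric axioms other than separation *)

Section GHk_epsilon.
Variables (R : realType) (k : nat).
Implicit Types X Y Z : klabeled_space R k.

(** A pointwise real bound stands in for the suprema and maxima in the extended reals, so that later
    estimates are linear arithmetic over [R]. *)
Definition tuple_distortion_le X Y (C : 'I_k -> set (X * Y)) (r : R) : Prop :=
  forall i j p q, C i p -> C j q ->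
    `|mdist p.1 q.1 - mdist p.2 q.2| <= r.

Lemma max_distortion_leP X Y (C : 'I_k -> set (X * Y)) (r : R) :
  (max_distortion C <= r%:E)%E <-> tuple_distortion_le C r.
Proof.
split=> [|Cr].
  rewrite /max_distortion => /bigmax_leP[_ h] i j p q Cp Cq.
  have /bigmax_leP[_ /(_ j isT)] := h i isT.
  rewrite -lee_fin; apply: le_trans; apply: ereal_sup_ubound.
  by exists (p, q).
apply/bigmax_leP; split; first exact: leNye.
move=> i _; apply/bigmax_leP; split; first exact: leNye.
move=> j _; apply: ge_ereal_sup => _ [[p q] [/= Cp Cq] <-].
by rewrite lee_fin; apply: Cr Cp Cq.
Qed.

Lemma GHk_le X Y (C : 'I_k -> set (X * Y)) (r : R) :
  ktuple_correspondence C -> tuple_distortion_le C r ->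
  (GHk X Y <= (r / 2)%:E)%E.
Proof.
move=> kC /max_distortion_leP Cr; rewrite /GHk mulrC EFinM.
apply: lee_wpmul2l; first by rewrite lee_fin.
by apply: le_trans Cr; apply: ereal_inf_lbound; exists C.
Qed.

(** The infimum need not be attained, so a strict bound is assumed. Without such a tuple, [2 * r]
    would be a lower bound of all the distortions. *)
Lemma GHk_lt X Y (r : R) : (GHk X Y < r%:E)%E ->
  exists2 C : 'I_k -> set (X * Y),
    ktuple_correspondence C & tuple_distortion_le C (2 * r).
Proof.
rewrite /GHk -lte_pdivlMl// invrK => h; apply: contrapT => nC.
move: h; rewrite ltNge => /negP; apply; apply: le_ereal_inf_tmp.
move=> _ [C kC <-]; rewrite leNgt; apply/negP => /ltW Cr.
by apply: nC; exists C => //; apply/max_distortion_leP.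
Qed.

Lemma ktuple_correspondence_nonempty X Y (C : 'I_k -> set (X * Y)) i :
  ktuple_correspondence C -> C i !=set0.
Proof.
move=> /(_ i)[_ C1 _]; have [x Xx] := kl_label_nonempty X i.
by move: Xx; rewrite -C1 => -[p Cp _]; exists p.
Qed.

(** As [k] is positive, some label exists; its correspondence contains a pair, and comparing this
    pair with itself rules out a negative distortion bound. *)
Lemma GHk_ge0 X Y : (0 < k)%N -> (0 <= GHk X Y)%E.
Proof.
move=> k0; rewrite leNgt; apply/negP => G0.
have [r r0 /GHk_lt[C kC Cr]] : exists2 r : R, r < 0 & (GHk X Y < r%:E)%E.
  case: (GHk X Y) G0 => [g||]//.
    by rewrite lte_fin => g0; exists (g / 2); rewrite ?lte_fin; lra.
  by exists (-1); rewrite ?ltNyr// ltrN10.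
have [p Cp] := ktuple_correspondence_nonempty (Ordinal k0) kC.
by have := le_trans (normr_ge0 _) (Cr _ _ _ _ Cp Cp); lra.
Qed.

Lemma GHk_lty X Y : (GHk X Y < +oo)%E.
Proof.
have [M hM] := compact_mdist_bounded (@kl_compact _ _ X).
have [N hN] := compact_mdist_bounded (@kl_compact _ _ Y).
(* The full products of labels are correspondences; their distortion is at most the sum of the
   bounds on the two diameters. *)
pose C (i : 'I_k) := kl_label X i `*` kl_label Y i.
apply: (@le_lt_trans _ _ ((M + N) / 2)%:E); last exact: ltry.
apply: (@GHk_le _ _ C) => [i|i j p q _ _].
  have [x Xx] := kl_label_nonempty X i; have [y Yy] := kl_label_nonempty Y i.
  split=> //; apply/seteqP; split.
  - by move=> _ [p [? ?] <-].
  - by move=> x' Xx'; exists (x', y).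
  - by move=> _ [p [? ?] <-].
  - by move=> y' Yy'; exists (x, y').
have := mdist_ge0 p.1 q.1; have := mdist_ge0 p.2 q.2.
have := hM p.1 q.1; have := hN p.2 q.2.
by move=> *; rewrite ler_distl; apply/andP; split; lra.
Qed.

Lemma GHk_fin_num X Y : (0 < k)%N -> GHk X Y \is a fin_num.
Proof. by move=> k0; rewrite ge0_fin_numE ?GHk_ge0 ?GHk_lty. Qed.

Lemma GHk_near X Y (e : R) : (0 < k)%N -> 0 < e ->
  exists2 C : 'I_k -> set (X * Y),
    ktuple_correspondence C & tuple_distortion_le C (2 * (fine (GHk X Y) + e)).
Proof.
move=> k0 e0; apply: GHk_lt.
by rewrite EFinD fineK ?GHk_fin_num// lteDl ?lte_fin// GHk_fin_num.
Qed.

Definition tuple_transpose X Y (C : 'I_k -> set (X * Y)) (i : 'I_k) :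
  set (Y * X) := [set p | C i (p.2, p.1)].

Lemma ktuple_correspondence_transpose X Y (C : 'I_k -> set (X * Y)) :
  ktuple_correspondence C -> ktuple_correspondence (tuple_transpose C).
Proof.
move=> kC i; have [sC C1 C2] := kC i; split.
- by move=> [y x] /sC[].
- by rewrite -C2; apply/seteqP; split=> [_ [[y x] ? <-]|_ [[x y] ? <-]];
    [exists (x, y)|exists (y, x)].
- by rewrite -C1; apply/seteqP; split=> [_ [[y x] ? <-]|_ [[x y] ? <-]];
    [exists (x, y)|exists (y, x)].
Qed.

Lemma tuple_distortion_le_transpose X Y (C : 'I_k -> set (X * Y)) (r : R) :
  tuple_distortion_le C r -> tuple_distortion_le (tuple_transpose C) r.
Proof. by move=> Cr i j p q Cp Cq; rewrite distrC; apply: Cr Cp Cq. Qed.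

Lemma GHk_sym_le X Y : (0 < k)%N -> (GHk Y X <= GHk X Y)%E.
Proof.
move=> k0; apply/lee_addgt0Pr => e e0.
have [C kC Cr] := @GHk_near X Y e k0 e0.
have := GHk_le (ktuple_correspondence_transpose kC)
  (tuple_distortion_le_transpose Cr).
by rewrite mulrAC mulfV// mul1r EFinD fineK ?GHk_fin_num.
Qed.

Definition tuple_comp X Y Z (C : 'I_k -> set (X * Y)) (D : 'I_k -> set (Y * Z))
    (i : 'I_k) : set (X * Z) :=
  [set p | exists2 y, C i (p.1, y) & D i (y, p.2)].

Lemma ktuple_correspondence_comp X Y Z (C : 'I_k -> set (X * Y))
    (D : 'I_k -> set (Y * Z)) :
  ktuple_correspondence C -> ktuple_correspondence D ->
  ktuple_correspondence (tuple_comp C D).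
Proof.
move=> kC kD i; have [sC C1 C2] := kC i; have [sD D1 D2] := kD i.
split.
- by move=> [x z] [y /sC[? _] /sD[_ ?]].
- apply/seteqP; split=> [_ [p [y /sC[? _] _] <-]//|x].
  rewrite -{1}C1 => -[[x0 y] Cp /= <-]; have [_ /=] := sC _ Cp.
  by rewrite -D1 => -[[y0 z] Dq /= qy]; subst y0; exists (x0, z) => //; exists y.
- apply/seteqP; split=> [_ [p [y _ /sD[_ ?]] <-]//|z].
  rewrite -{1}D2 => -[[y z0] Dp /= <-]; have [/= + _] := sD _ Dp.
  by rewrite -C2 => -[[x y0] Cq /= qy]; subst y0; exists (x, z0) => //; exists y.
Qed.

Lemma tuple_distortion_le_comp X Y Z (C : 'I_k -> set (X * Y))
    (D : 'I_k -> set (Y * Z)) (r s : R) :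
  tuple_distortion_le C r -> tuple_distortion_le D s ->
  tuple_distortion_le (tuple_comp C D) (r + s).
Proof.
move=> Cr Ds i j p q [y Cy Dy] [y' Cy' Dy'].
apply: le_trans (ler_distD (mdist y y') _ _) _.
by apply: lerD; [apply: Cr Cy Cy'|apply: Ds Dy Dy'].
Qed.

Lemma GHk_triangle X Y Z : (0 < k)%N ->
  (GHk X Z <= GHk X Y + GHk Y Z)%E.
Proof.
(* Each of the two near-optimal tuples spends half of the error [e]; their composition has at most
   the sum of the distortions. *)
move=> k0; apply/lee_addgt0Pr => e e0; have e20 : 0 < e / 2 by rewrite divr_gt0.
have [C kC Cr] := @GHk_near X Y _ k0 e20.
have [D kD Ds] := @GHk_near Y Z _ k0 e20.
apply: (le_trans (GHk_le (ktuple_correspondence_comp kC kD)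
  (tuple_distortion_le_comp Cr Ds))).
rewrite -[GHk X Y in leRHS](fineK (GHk_fin_num X Y k0)).
rewrite -[GHk Y Z in leRHS](fineK (GHk_fin_num Y Z k0)) -!EFinD lee_fin.
lra.
Qed.

Lemma k_isomorphic_GHk0 X Y : (0 < k)%N -> k_isomorphic X Y -> GHk X Y = 0%E.
Proof.
move=> k0 [phi [_ iso lab]]; apply/eqP; rewrite eq_le GHk_ge0// andbT.
(* The graph of [phi] over each label has distortion 0. *)
pose C i := [set (x, phi x) | x in kl_label X i].
have -> : 0%E = (0 / 2)%:E :> \bar R by rewrite mul0r.
apply: (@GHk_le _ _ C).
  move=> i; split.
  - by move=> _ [x Xx <-]; split=> //=; rewrite -lab; exists x.
  - apply/seteqP; split=> [_ [_ [x Xx <-] <-]//|x Xx].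
    by exists (x, phi x) => //; exists x.
  - rewrite -lab; apply/seteqP; split=> [_ [_ [x Xx <-] <-]|_ [x Xx <-]].
      by exists x.
    by exists (x, phi x) => //; exists x.
by move=> i j _ _ [x _ <-] [x' _ <-] /=; rewrite iso subrr normr0.
Qed.

End GHk_epsilon.

(** * Limits of correspondences along an ultrafilter, and separation *)

Section limit_correspondence.
Variables (R : realType) (k : nat).

(** The label [i] may vary with [n]: a single relation serves all labels, so that it yields one map
    even where labels overlap. *)
Definition limit_correspondence (X Y : klabeled_space R k)
    (F : set_system nat) (C : nat -> 'I_k -> set (X * Y)) : set (X * Y) :=
  [set p | forall e : R, 0 < e -> \forall n \near F,
    exists i q, [/\ C n i q, mdist p.1 q.1 < e & mdist p.2 q.2 < e]].

Lemma limit_correspondence_isometric (X Y : klabeled_space R k)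
    (F : set_system nat) {FF : ProperFilter F}
    (C : nat -> 'I_k -> set (X * Y)) :
  \oo `<=` F -> (forall n, tuple_distortion_le (C n) n.+1%:R^-1) ->
  forall p q, limit_correspondence F C p -> limit_correspondence F C q ->
    mdist p.1 q.1 = mdist p.2 q.2.
Proof.
move=> Foo Cn p q Lp Lq; apply/eqP; rewrite -subr_eq0 -normr_le0.
suff h (e : R) : 0 < e -> `|mdist p.1 q.1 - mdist p.2 q.2| <= e.
  by apply/ler_addgt0Pr => e e0; rewrite add0r; exact: h.
(* Four fifths of [e] pay for replacing the four points by approximations, the last one for the
   distortion of [C n]. The approximating pairs may carry different labels, which the bound across
   all [i] and [j] allows. *)
move=> e0; have d0 : 0 < e / 5 by rewrite divr_gt0.
have Fn : \forall n \near F, n.+1%:R^-1 < e / 5 :> R.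
  by apply: Foo; apply: near_infty_natSinv_lt (PosNum d0).
have [n [[i [p' [Cp p1 p2]]] [[j [q' [Cq q1 q2]]] n5]]] :=
  filter_ex (filterI (Lp _ d0) (filterI (Lq _ d0) Fn)).
have h1 := mdist_lipschitz p.1 q.1 p'.1 q'.1.
have h2 := mdist_lipschitz p.2 q.2 p'.2 q'.2.
have h3 := le_trans (Cn _ _ _ _ _ Cp Cq) (ltW n5).
move: h1 h2 h3; rewrite !ler_distl => /andP[? ?] /andP[? ?] /andP[? ?].
by apply/andP; split; lra.
Qed.

(** Choose partners [y n] of [x] in [C n i]. They stay in a closed, hence compact, label, so they
    converge in it along the ultrafilter. *)
Lemma limit_correspondence_total (X Y : klabeled_space R k)
    (F : set_system nat) {FU : UltraFilter F}
    (C : nat -> 'I_k -> set (X * Y)) :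
  closed_labels Y -> (forall n, ktuple_correspondence (C n)) ->
  forall i x, kl_label X i x ->
    exists2 y, kl_label Y i y & limit_correspondence F C (x, y).
Proof.
move=> cY kC i x Xx.
have /choice[y Cy] n : exists y, C n i (x, y).
  have [_ C1 _] := kC n i.
  by move: Xx; rewrite -C1 => -[[x0 y] Cp <-]; exists y.
have cYi : compact (kl_label Y i).
  by apply: subclosed_compact (cY i) (@kl_compact _ _ Y) _.
have Fy : (y @ F) (kl_label Y i).
  apply: (@filterE _ F) => n /=.
  by have [sC _ _] := kC n i; have [] := sC _ (Cy n).
have [l [Yl yl]] : kl_label Y i `&` [set l | y @ F --> l] !=set0.
  by move: cYi; rewrite compact_ultra => /(_ (y @ F) (fmap_ultra y FU) Fy); apply.
exists l => // e e0.
apply: filterS (metricType_numDomainType.cvgr_dist_lt yl e0) => n ln.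
by exists i, (x, y n); split=> //=; rewrite mdistxx.
Qed.

Lemma limit_correspondence_transpose (X Y : klabeled_space R k)
    (F : set_system nat) {FF : Filter F}
    (C : nat -> 'I_k -> set (X * Y)) x y :
  limit_correspondence F (fun n => tuple_transpose (C n)) (y, x) ->
  limit_correspondence F C (x, y).
Proof.
move=> L e e0; apply: filterS (L e e0) => n [i [q [Cq q1 q2]]].
by exists i, (q.2, q.1).
Qed.

Lemma GHk0_k_isomorphic (X Y : klabeled_space R k) : (0 < k)%N ->
  closed_labels X -> closed_labels Y -> GHk X Y = 0%E -> k_isomorphic X Y.
Proof.
move=> k0 cX cY G0.
have /choice[C CP] n : exists C : 'I_k -> set (X * Y),
    ktuple_correspondence C /\ tuple_distortion_le C n.+1%:R^-1.
  (* The error is halved because the distortion bound is twice the distance plus the error. *)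
  have [|C kC Cr] := @GHk_near _ _ X Y (n.+1%:R^-1 / 2) k0.
    by rewrite divr_gt0.
  exists C; split=> //; move: Cr; rewrite G0 add0r.
  by rewrite mulrCA mulfV// mulr1.
have kC n := (CP n).1; have Cr n := (CP n).2.
(* Refining [\oo] ensures that the distortions tend to 0 along [F]. *)
have [F [FU Foo]] := ultraFilterLemma (F := \oo) _.
have FP : ProperFilter F by case: FU.
pose S := limit_correspondence F C.
have Siso p q : S p -> S q -> mdist p.1 q.1 = mdist p.2 q.2.
  exact: limit_correspondence_isometric.
have SX i x : kl_label X i x -> exists2 y, kl_label Y i y & S (x, y).
  exact: limit_correspondence_total.
have SY i y : kl_label Y i y -> exists2 x, kl_label X i x & S (x, y).
  move=> /(limit_correspondence_total cX
    (fun n => ktuple_correspondence_transpose (kC n)))[x Xx Sx].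
  by exists x => //; apply: limit_correspondence_transpose.
(* Since [S] preserves distances, two partners of one point are at distance 0, and symmetrically. *)
have Sfun x y y' : S (x, y) -> S (x, y') -> y = y'.
  by move=> Sy Sy'; apply: mdist_positivity; rewrite -(Siso _ _ Sy Sy') mdistxx.
have Sinj x x' y : S (x, y) -> S (x', y) -> x = x'.
  by move=> Sx Sx'; apply: mdist_positivity; rewrite (Siso _ _ Sx Sx') mdistxx.
have /choice[phi Sphi] x : exists y, S (x, y).
  have : (\bigcup_i kl_label X i) x by rewrite kl_label_cover.
  by move=> [i _ /SX[y _ ?]]; exists y.
have /choice[psi Spsi] y : exists x, S (x, y).
  have : (\bigcup_i kl_label Y i) y by rewrite kl_label_cover.
  by move=> [i _ /SY[x _ ?]]; exists x.
exists phi; split.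
- by exists psi => [x|y]; [apply: Sinj (Spsi _) _|apply: Sfun (Sphi _) _].
- by move=> x x'; rewrite (Siso _ _ (Sphi x) (Sphi x')).
(* The value [phi x] was chosen without regard to [i], but by uniqueness it is the partner that lies
   in the label [i]. *)
- move=> i; apply/seteqP; split=> [_ [x /SX[y Yy Sy] <-]|y /SY[x Xx Sx]].
    by rewrite (Sfun _ _ _ (Sphi x) Sy).
  by exists x => //; apply: Sfun (Sphi x) Sx.
Qed.

End limit_correspondence.

Local Open Scope ereal_scope.

Theorem theorem2p3p6 (R : realType) (k : nat) (hk : (0 < k)%N) :
  (forall X Y : klabeled_space R k, 0 <= GHk X Y /\ GHk X Y < +oo) /\
  (forall X Y : klabeled_space R k, GHk X Y = GHk Y X) /\
  (forall X Y Z : klabeled_space R k, GHk X Z <= GHk X Y + GHk Y Z) /\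
  (forall X Y : klabeled_space R k, k_isomorphic X Y -> GHk X Y = 0) /\
  (forall X Y : klabeled_space R k, closed_labels X -> closed_labels Y ->
     (GHk X Y = 0 <-> k_isomorphic X Y)).
Proof.
split; first by move=> X Y; split; [exact: GHk_ge0|exact: GHk_lty].
split; first by move=> X Y; apply/eqP; rewrite eq_le !GHk_sym_le.
split; first by move=> X Y Z; exact: GHk_triangle.
split; first by move=> X Y; exact: k_isomorphic_GHk0.
move=> X Y cX cY; split; first exact: GHk0_k_isomorphic.
exact: k_isomorphic_GHk0.
Qed.
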